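(* Let $\varepsilon$ be a primitive cubic root of unity. For all $\alpha,\beta\in\{-1,1\}$, the symbol algebra $A=\left(\frac{\alpha,\beta}{\mathbb{Q}(\varepsilon),\varepsilon}\right)$ is not a division algebra.
   Context: Let $K$ be a field containing a primitive $n$-th root of unity $\zeta$, and let $\alpha,\beta\in K^*$. The symbol algebra $\left(\frac{\alpha,\beta}{K,\zeta}\right)$ is the unital associative $K$-algebra generated by elements $x,y$ subject to the relations $x^n=\alpha$, $y^n=\beta$, $yx=\zeta xy$. Here $n=3$, so the algebra has dimension $9$ over $K=\mathbb{Q}(\varepsilon)$. A nonzero algebra $A$ is a division algebra if for all $a,b\in A$ with $a\ne 0$ the equations $ax=b$ and $ya=b$ have unique solutions; for finite-dimensional $A$ this is equivalent to $A$ having no zero divisors. *)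

(* Defs.v *)
From HB Require Import structures.
From mathcomp Require Import all_boot all_order all_algebra all_field.
From mathcomp Require Import boolp.

Set Implicit Arguments.
Unset Strict Implicit.
Unset Printing Implicit Defensive.

Import GRing.Theory.
Local Open Scope ring_scope.
Local Open Scope quotient_scope.

(* Expressions in two noncommuting letters over [K]. *)
Inductive symbol_term (K : fieldType) : Type :=
  | TermX
  | TermY
  | TermC of K
  | TermAdd of symbol_term K & symbol_term K
  | TermMul of symbol_term K & symbol_term K.

Arguments TermX {K}.
Arguments TermY {K}.

HB.instance Definition _ (K : fieldType) := gen_eqMixin (symbol_term K).
HB.instance Definition _ (K : fieldType) := gen_choiceMixin (symbol_term K).

Fixpoint TermExp (K : fieldType) (t : symbol_term K) (m : nat) :=
  if m is m'.+1 then TermMul t (TermExp t m') else TermC 1.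

(* The least congruence making the terms a unital associative [K]-algebra, with
   [TermC] as structure map, in which x^n = alpha, y^n = beta, yx = zeta xy.
   The opposite of [t] is [TermMul (TermC (-1)) t]. *)
Inductive symbol_rel (K : fieldType) (n : nat) (zeta alpha beta : K) :
    symbol_term K -> symbol_term K -> Prop :=
  | rel_refl t : symbol_rel n zeta alpha beta t t
  | rel_sym s t :
      symbol_rel n zeta alpha beta s t -> symbol_rel n zeta alpha beta t s
  | rel_trans s t u :
      symbol_rel n zeta alpha beta s t -> symbol_rel n zeta alpha beta t u ->
      symbol_rel n zeta alpha beta s u
  | rel_add s s' t t' :
      symbol_rel n zeta alpha beta s s' -> symbol_rel n zeta alpha beta t t' ->
      symbol_rel n zeta alpha beta (TermAdd s t) (TermAdd s' t')
  | rel_mul s s' t t' :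
      symbol_rel n zeta alpha beta s s' -> symbol_rel n zeta alpha beta t t' ->
      symbol_rel n zeta alpha beta (TermMul s t) (TermMul s' t')
  | rel_addA s t u :
      symbol_rel n zeta alpha beta
        (TermAdd s (TermAdd t u)) (TermAdd (TermAdd s t) u)
  | rel_addC s t :
      symbol_rel n zeta alpha beta (TermAdd s t) (TermAdd t s)
  | rel_add0 t :
      symbol_rel n zeta alpha beta (TermAdd (TermC 0) t) t
  | rel_mulA s t u :
      symbol_rel n zeta alpha beta
        (TermMul s (TermMul t u)) (TermMul (TermMul s t) u)
  | rel_mul1 t :
      symbol_rel n zeta alpha beta (TermMul (TermC 1) t) t
  | rel_mulDl s t u :
      symbol_rel n zeta alpha beta
        (TermMul (TermAdd s t) u) (TermAdd (TermMul s u) (TermMul t u))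
  | rel_mulDr s t u :
      symbol_rel n zeta alpha beta
        (TermMul s (TermAdd t u)) (TermAdd (TermMul s t) (TermMul s u))
  | rel_mul0 t :
      symbol_rel n zeta alpha beta (TermMul (TermC 0) t) (TermC 0)
  | rel_constD a b :
      symbol_rel n zeta alpha beta (TermC (a + b)) (TermAdd (TermC a) (TermC b))
  | rel_constM a b :
      symbol_rel n zeta alpha beta (TermC (a * b)) (TermMul (TermC a) (TermC b))
  | rel_constC a t :
      symbol_rel n zeta alpha beta (TermMul (TermC a) t) (TermMul t (TermC a))
  | rel_xn :
      symbol_rel n zeta alpha beta (TermExp TermX n) (TermC alpha)
  | rel_yn :
      symbol_rel n zeta alpha beta (TermExp TermY n) (TermC beta)
  | rel_yx :
      symbol_rel n zeta alpha beta
        (TermMul TermY TermX) (TermMul (TermC zeta) (TermMul TermX TermY)).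

(* Nontriviality: the terms act on the functions f : nat -> nat -> K such that
   f (i + n) j = alpha f i j and f i (j + n) = beta f i j, by
   (x f) i j = zeta^j f (i+1) j and (y f) i j = f i (j+1). *)
Section Nontrivial.
Variables (K : fieldType) (n : nat) (zeta alpha beta : K).

Let V := nat -> nat -> K.

Fixpoint term_act (t : symbol_term K) (f : V) : V :=
  match t with
  | TermX => fun i j => zeta ^+ j * f i.+1 j
  | TermY => fun i j => f i j.+1
  | TermC a => fun i j => a * f i j
  | TermAdd s u => fun i j => term_act s f i j + term_act u f i j
  | TermMul s u => term_act s (term_act u f)
  end.

Definition quasi_periodic (f : V) := forall i j,
  f (n + i)%N j = alpha * f i j /\ f i (n + j)%N = beta * f i j.

Lemma term_act_ext t f g : f =2 g -> term_act t f =2 term_act t g.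
Proof.
elim: t f g => [||a|s IHs u IHu|s IHs u IHu] f g fg i j /=; rewrite ?fg //.
- by rewrite (IHs _ _ fg) (IHu _ _ fg).
- exact/IHs/IHu.
Qed.

Lemma term_actD t f g :
  term_act t (fun i j => f i j + g i j)
  =2 fun i j => term_act t f i j + term_act t g i j.
Proof.
elim: t f g => [||a|s IHs u IHu|s IHs u IHu] f g i j //=; rewrite ?mulrDr //.
- by rewrite IHs IHu addrACA.
- by rewrite (term_act_ext _ (IHu _ _)) IHs.
Qed.

Lemma term_actZ t a f :
  term_act t (fun i j => a * f i j) =2 fun i j => a * term_act t f i j.
Proof.
elim: t a f => [||b|s IHs u IHu|s IHs u IHu] a f i j //=; rewrite 1?mulrCA //.
- by rewrite IHs IHu mulrDr.
- by rewrite (term_act_ext _ (IHu _ _)) IHs.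
Qed.

Hypothesis zeta_n : zeta ^+ n = 1.

Lemma term_act_qp t f : quasi_periodic f -> quasi_periodic (term_act t f).
Proof.
elim: t f => [||a|s IHs u IHu|s IHs u IHu] f qf i j /=.
- rewrite -addnS exprD zeta_n mul1r.
  by split; rewrite 1?(qf _ _).1 1?(qf _ _).2 mulrCA.
- by rewrite -addnS; split; rewrite 1?(qf _ _).1 1?(qf _ _).2.
- by split; rewrite 1?(qf _ _).1 1?(qf _ _).2 mulrCA.
- rewrite (IHs _ qf i j).1 (IHs _ qf i j).2 (IHu _ qf i j).1 (IHu _ qf i j).2.
  by rewrite !mulrDr.
- exact/IHs/IHu.
Qed.

Lemma term_act_Xn m f i j :
  term_act (TermExp TermX m) f i j = zeta ^+ (j * m) * f (m + i)%N j.
Proof.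
elim: m i => [|m IH] i /=; first by rewrite muln0 expr0.
by rewrite IH mulrA -exprD mulnS addnS.
Qed.

Lemma term_act_Yn m f i j :
  term_act (TermExp TermY m) f i j = f i (m + j)%N.
Proof. by elim: m j => [|m IH] j /=; rewrite ?mul1r // IH addnS. Qed.

Lemma term_act_rel s t : symbol_rel n zeta alpha beta s t ->
  forall f, quasi_periodic f -> term_act s f =2 term_act t f.
Proof.
elim=> {s t} /=.
- by [].
- by move=> s t _ IH f qf i j; rewrite IH.
- by move=> s t u _ IH1 _ IH2 f qf i j; rewrite IH1 ?IH2.
- by move=> s s' t t' _ IH1 _ IH2 f qf i j; rewrite IH1 ?IH2.
- move=> s s' t t' _ IH1 _ IH2 f qf i j.
  by rewrite (term_act_ext _ (IH2 _ _)) // IH1 //; apply: term_act_qp.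
- by move=> s t u f _ i j; rewrite addrA.
- by move=> s t f _ i j; rewrite addrC.
- by move=> t f _ i j; rewrite mul0r add0r.
- by [].
- by move=> t f _ i j; rewrite mul1r.
- by [].
- by move=> s t u f _; apply: term_actD.
- by move=> t f _ i j; rewrite !mul0r.
- by move=> a b f _ i j; rewrite mulrDl.
- by move=> a b f _ i j; rewrite mulrA.
- by move=> a t f _ i j; rewrite term_actZ.
- move=> f qf i j; rewrite term_act_Xn mulnC exprM zeta_n expr1n mul1r.
  by case: (qf i j).
- by move=> f qf i j; rewrite term_act_Yn; case: (qf i j).
- by move=> f _ i j; rewrite exprS mulrA.
Qed.

Lemma symbol_rel_neq : (0 < n)%N ->
  ~ symbol_rel n zeta alpha beta (TermC 1) (TermC 0).
Proof.
move=> n_gt0 /term_act_rel h.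
have qf : quasi_periodic (fun i j => alpha ^+ (i %/ n) * beta ^+ (j %/ n)).
  move=> i j; rewrite !divnDl // divnn n_gt0 !exprS -mulrA.
  by split=> //; rewrite mulrCA.
move: (h _ qf 0%N 0%N) => /=; rewrite !div0n !expr0 !mulr1 => /eqP.
by rewrite oner_eq0.
Qed.

End Nontrivial.

Section SymbolAlgebra.
Variables (K : fieldType) (n : nat) (zeta alpha beta : K).
Hypothesis zeta_prim : n.-primitive_root zeta.

Local Notation R := (symbol_rel n zeta alpha beta).

Definition symbol_eq (s t : symbol_term K) : bool := `[< R s t >].

Lemma symbol_eq_equiv : equiv_class_of symbol_eq.
Proof.
split=> [t|s t|t s u].
- exact/asboolP/rel_refl.
- by apply/asboolP/asboolP; apply: rel_sym.
- by move=> /asboolP st /asboolP tu; apply/asboolP; apply: rel_trans st tu.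
Qed.

Canonical symbol_eq_rel := EquivRelPack symbol_eq_equiv.

(* The proof that [zeta] is primitive is only used to know that the quotient is
   not the zero ring. *)
Definition symbol_algebra of n.-primitive_root zeta : Type :=
  {eq_quot symbol_eq_rel}.

Local Notation A := (symbol_algebra zeta_prim).

HB.instance Definition _ := Choice.on A.

Let cl (t : symbol_term K) : A := \pi_{eq_quot symbol_eq_rel} t.
Let rp (u : A) : symbol_term K := repr (u : {eq_quot symbol_eq_rel}).

Let clP s t : R s t <-> cl s = cl t.
Proof.
split=> [st|/eqmodP/asboolP //]; apply/eqmodP; exact/asboolP.
Qed.

Let rpK u : cl (rp u) = u. Proof. exact: reprK. Qed.

Let rp_cl t : R (rp (cl t)) t. Proof. by apply/clP; rewrite rpK. Qed.

Let clW (P : A -> Prop) : (forall t, P (cl t)) -> forall u, P u.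
Proof. by move=> h u; rewrite -(rpK u). Qed.

Let add (u v : A) : A := cl (TermAdd (rp u) (rp v)).
Let mul (u v : A) : A := cl (TermMul (rp u) (rp v)).
Let opp (u : A) : A := mul (cl (TermC (-1))) u.
Let scale (a : K) (u : A) : A := mul (cl (TermC a)) u.

Let clD s t : add (cl s) (cl t) = cl (TermAdd s t).
Proof. by apply/clP/rel_add; apply: rp_cl. Qed.

Let clM s t : mul (cl s) (cl t) = cl (TermMul s t).
Proof. by apply/clP/rel_mul; apply: rp_cl. Qed.

Let addA : associative add.
Proof.
by elim/clW=> s; elim/clW=> t; elim/clW=> u; rewrite !clD; apply/clP/rel_addA.
Qed.

Let addC : commutative add.
Proof. by elim/clW=> s; elim/clW=> t; rewrite !clD; apply/clP/rel_addC. Qed.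

Let add0 : left_id (cl (TermC 0)) add.
Proof. by elim/clW=> t; rewrite clD; apply/clP/rel_add0. Qed.

Let mulA' : associative mul.
Proof.
by elim/clW=> s; elim/clW=> t; elim/clW=> u; rewrite !clM; apply/clP/rel_mulA.
Qed.

Let mul1l : left_id (cl (TermC 1)) mul.
Proof. by elim/clW=> t; rewrite clM; apply/clP/rel_mul1. Qed.

Let constC a u : mul (cl (TermC a)) u = mul u (cl (TermC a)).
Proof. by elim/clW: u => t; rewrite !clM; apply/clP/rel_constC. Qed.

Let mul1r' : right_id (cl (TermC 1)) mul.
Proof. by move=> u; rewrite -constC mul1l. Qed.

Let mulDl : left_distributive mul add.
Proof.
by elim/clW=> s; elim/clW=> t; elim/clW=> u; rewrite !(clD, clM);
  apply/clP/rel_mulDl.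
Qed.

Let mulDr : right_distributive mul add.
Proof.
by elim/clW=> s; elim/clW=> t; elim/clW=> u; rewrite !(clD, clM);
  apply/clP/rel_mulDr.
Qed.

Let constD a b : cl (TermC (a + b)) = add (cl (TermC a)) (cl (TermC b)).
Proof. by rewrite clD; apply/clP/rel_constD. Qed.

Let constM a b : cl (TermC (a * b)) = mul (cl (TermC a)) (cl (TermC b)).
Proof. by rewrite clM; apply/clP/rel_constM. Qed.

Let mul0 u : mul (cl (TermC 0)) u = cl (TermC 0).
Proof. by elim/clW: u => t; rewrite clM; apply/clP/rel_mul0. Qed.

Let addN : left_inverse (cl (TermC 0)) opp add.
Proof.
by move=> u; rewrite -{2}(mul1l u) /opp -mulDl -constD addNr mul0.
Qed.

Let one_neq0 : cl (TermC 1) != cl (TermC 0).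
Proof.
apply/eqP => /clP; apply: symbol_rel_neq; last exact: prim_order_gt0 zeta_prim.
exact: prim_expr_order zeta_prim.
Qed.

HB.instance Definition _ := GRing.isZmodule.Build A addA addC add0 addN.

HB.instance Definition _ :=
  GRing.Zmodule_isNzRing.Build A mulA' mul1l mul1r' mulDl mulDr one_neq0.

Let scaleA a b u : scale a (scale b u) = scale (a * b) u.
Proof. by rewrite /scale constM mulA'. Qed.

Let scaleDl u : {morph scale^~ u : a b / a + b}.
Proof. by move=> a b; rewrite /scale constD mulDl. Qed.

HB.instance Definition _ := GRing.Zmodule_isLmodule.Build K A
  scaleA mul1l (fun a => mulDr (cl (TermC a))) scaleDl.

Let scaleAl (a : K) (u v : A) : a *: (u * v) = (a *: u) * v.
Proof. exact: mulA'. Qed.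

HB.instance Definition _ := GRing.Lmodule_isLalgebra.Build K A scaleAl.

Let scaleAr (a : K) (u v : A) : a *: (u * v) = u * (a *: v).
Proof.
transitivity (mul (mul (cl (TermC a)) u) v); first exact: mulA'.
by rewrite constC -mulA'.
Qed.

HB.instance Definition _ := GRing.Lalgebra_isAlgebra.Build K A scaleAr.

Definition symbol_x : A := cl TermX.
Definition symbol_y : A := cl TermY.

Let clC a : cl (TermC a) = a%:A :> A.
Proof. by symmetry; apply: mul1r'. Qed.

Let cl_exp t m : cl (TermExp t m) = cl t ^+ m :> A.
Proof. by elim: m => [|m IH] //=; rewrite exprS -IH -clM. Qed.

Lemma symbol_xn : symbol_x ^+ n = alpha%:A.
Proof. by rewrite -cl_exp -clC; apply/clP/rel_xn. Qed.

Lemma symbol_yn : symbol_y ^+ n = beta%:A.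
Proof. by rewrite -cl_exp -clC; apply/clP/rel_yn. Qed.

Lemma symbol_yx : symbol_y * symbol_x = zeta *: (symbol_x * symbol_y).
Proof.
transitivity (cl (TermMul TermY TermX)); first exact: clM.
transitivity (cl (TermMul (TermC zeta) (TermMul TermX TermY))).
  exact/clP/rel_yx.
by rewrite -clM -clM.
Qed.

Section Universal.
Variables (B : algType K) (u v : B).
Hypotheses (un : u ^+ n = alpha%:A) (vn : v ^+ n = beta%:A).
Hypothesis vu : v * u = zeta *: (u * v).

Fixpoint term_eval (t : symbol_term K) : B :=
  match t with
  | TermX => u
  | TermY => v
  | TermC a => a%:A
  | TermAdd s t => term_eval s + term_eval t
  | TermMul s t => term_eval s * term_eval t
  end.

Let eval_exp t m : term_eval (TermExp t m) = term_eval t ^+ m.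
Proof. by elim: m => [|m IH] /=; rewrite ?scale1r // IH exprS. Qed.

Let eval_rel s t : R s t -> term_eval s = term_eval t.
Proof.
elim=> {s t} //=.
- by move=> s t w _ -> _ ->.
- by move=> s s' t t' _ -> _ ->.
- by move=> s s' t t' _ -> _ ->.
- by move=> *; rewrite addrA.
- by move=> *; rewrite addrC.
- by move=> *; rewrite scale0r add0r.
- by move=> *; rewrite mulrA.
- by move=> *; rewrite scale1r mul1r.
- by move=> *; rewrite mulrDl.
- by move=> *; rewrite mulrDr.
- by move=> *; rewrite scale0r mul0r.
- by move=> *; rewrite scalerDl.
- by move=> *; rewrite mulr_algl scalerA.
- by move=> *; rewrite mulr_algl mulr_algr.
- by rewrite eval_exp.
- by rewrite eval_exp.
- by rewrite mulr_algl.
Qed.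

Let lift (w : A) : B := term_eval (rp w).

Let lift_cl t : lift (cl t) = term_eval t.
Proof. exact/eval_rel/rp_cl. Qed.

Let lift_linear : linear lift.
Proof.
move=> a; elim/clW=> s; elim/clW=> t.
have -> : a *: cl s + cl t = cl (TermAdd (TermMul (TermC a) s) t).
  by rewrite -clD -clM.
by rewrite !lift_cl /= mulr_algl.
Qed.

Let lift_monoid : monoid_morphism lift.
Proof.
split; first by rewrite [LHS]lift_cl /= scale1r.
elim/clW=> s; elim/clW=> t.
have -> : cl s * cl t = cl (TermMul s t) by rewrite -clM.
by rewrite !lift_cl.
Qed.

HB.instance Definition _ := GRing.isLinear.Build K A B _ lift lift_linear.
HB.instance Definition _ := GRing.isMonoidMorphism.Build A B lift lift_monoid.

Lemma symbol_algebra_universal :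
  exists f : {lrmorphism A -> B}, [/\ f symbol_x = u, f symbol_y = v &
    forall g : {lrmorphism A -> B},
      g symbol_x = u -> g symbol_y = v -> g =1 f].
Proof.
exists (lift : {lrmorphism A -> B}); split; rewrite ?[LHS]lift_cl //.
move=> g gx gy; elim/clW=> t; rewrite [RHS]lift_cl.
elim: t => [||a|s IHs t IHt|s IHs t IHt] //=.
- by rewrite clC linearZ rmorph1.
- by rewrite -IHs -IHt -rmorphD -clD.
- by rewrite -IHs -IHt -rmorphM -clM.
Qed.

End Universal.
End SymbolAlgebra.

(* An [algType] is a nonzero algebra. *)
Definition is_division_algebra (K : fieldType) (A : algType K) : Prop :=
  forall a b : A, a != 0 ->
    (exists! u : A, a * u = b) /\ (exists! v : A, v * a = b).

(* Main.v *)
Require Import Defs.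
From mathcomp Require Import all_boot all_order all_algebra all_field.

(** Since [alpha = alpha ^ 3], the generator [x] satisfies [x ^ 3 = alpha ^ 3],
    a polynomial equation that splits over the base field, as the field
    contains the cubic roots of unity. In a division algebra, one of the linear
    factors evaluated at [x] would vanish, making [x] a scalar
    ([division_algebra_root_of_unity]). A scalar is central, whereas [x] and [y]
    commute only up to the factor [zeta <> 1]; as [y] is nonzero, this is
    absurd ([symbol_x_not_scalar]). The argument applies whenever [alpha] is a
    nonzero n-th power, for any [n > 1]. *)

Set Implicit Arguments.
Unset Strict Implicit.

Import GRing.Theory.
Local Open Scope ring_scope.

Lemma division_algebra_mul_eq0 (K : fieldType) (A : algType K) (a b : A) :
  is_division_algebra A -> a * b = 0 -> a = 0 \/ b = 0.
Proof.
move=> divA ab0; have [->|a_neq0] := eqVneq a 0; first by left.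
have [[u [_ u_uniq]] _] := divA a 0 a_neq0.
by right; rewrite -(u_uniq b ab0) (u_uniq 0 (mulr0 a)).
Qed.

Lemma division_algebra_prod_eq0 (K : fieldType) (A : algType K) (I : eqType)
    (r : seq I) (F : I -> A) :
  is_division_algebra A -> \prod_(i <- r) F i = 0 ->
  exists2 i, i \in r & F i = 0.
Proof.
move=> divA; elim: r => [|i r IH].
  by rewrite big_nil => /eqP; rewrite oner_eq0.
rewrite big_cons => /(division_algebra_mul_eq0 divA) [Fi0|/IH[j jr Fj0]].
  by exists i; rewrite ?mem_head.
by exists j; rewrite // inE jr orbT.
Qed.

(** Evaluating at [z] the factorization of [X ^ n - 1] over [K] writes
    [z ^ n - 1 = 0] as a product of differences between [z] and scalars. *)
Lemma division_algebra_root_of_unity (K : fieldType) (A : algType K) (n : nat)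
    (zeta : K) (z : A) :
  n.-primitive_root zeta -> is_division_algebra A -> z ^+ n = 1 ->
  exists c : K, z = c%:A.
Proof.
move=> zeta_prim divA zn1.
have : horner_alg z ('X^n - 1) = 0.
  by rewrite rmorphB rmorphXn rmorph1 /= horner_algX zn1 subrr.
rewrite -(factor_Xn_sub_1 zeta_prim) rmorph_prod /=.
case/(division_algebra_prod_eq0 divA)=> i _ zi0.
exists (zeta ^+ i); apply/eqP; rewrite -subr_eq0 -zi0.
by rewrite rmorphB /= horner_algX horner_algC.
Qed.

(** A scalar value of [x] would turn [y x = zeta x y] into
    [(1 - zeta) x y = 0] and so force [y = 0], against [y ^ n = beta]. *)
Lemma symbol_x_not_scalar (K : fieldType) (n : nat) (zeta alpha beta : K)
    (zeta_prim : n.-primitive_root zeta) (c : K) :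
  (1 < n)%N -> alpha != 0 -> beta != 0 ->
  symbol_x alpha beta zeta_prim <> c%:A.
Proof.
move=> n_gt1 alpha_neq0 beta_neq0 x_c.
have n_gt0 : (0 < n)%N := ltnW n_gt1.
have c_neq0 : c != 0.
  apply: contraNneq alpha_neq0 => c0.
  have /esym/eqP := symbol_xn alpha beta zeta_prim.
  by rewrite x_c c0 scale0r expr0n gtn_eqF // scaler_eq0 oner_eq0 orbF.
have zeta_neq1 : zeta != 1.
  apply/negP => /eqP zeta1.
  have := prim_order_dvd zeta_prim 1%N.
  by rewrite expr1 zeta1 eqxx dvdn1 gtn_eqF.
have /eqP := symbol_yx alpha beta zeta_prim.
rewrite x_c mulr_algl mulr_algr scalerA -subr_eq0 -scalerBl scaler_eq0.
rewrite -{1}[c]mul1r -mulrBl mulf_eq0 subr_eq0 eq_sym (negPf zeta_neq1).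
rewrite (negPf c_neq0) /= => /eqP y0.
have /esym/eqP := symbol_yn alpha beta zeta_prim.
rewrite y0 expr0n gtn_eqF // scaler_eq0 oner_eq0 orbF.
by rewrite (negPf beta_neq0).
Qed.

(** When [x ^ n] is an n-th power [a ^ n], rescaling [x] by [a^-1] gives an
    n-th root of unity in the algebra. *)
Lemma symbol_algebra_not_division (K : fieldType) (n : nat) (zeta a beta : K)
    (zeta_prim : n.-primitive_root zeta) :
  (1 < n)%N -> a != 0 -> beta != 0 ->
  ~ is_division_algebra (symbol_algebra (a ^+ n) beta zeta_prim).
Proof.
move=> n_gt1 a_neq0 beta_neq0 divA.
set x := symbol_x (a ^+ n) beta zeta_prim.
have zn1 : (a^-1 *: x) ^+ n = 1.
  by rewrite exprZn symbol_xn scalerA exprVn mulVf ?expf_neq0 // scale1r.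
have [c zc] := division_algebra_root_of_unity zeta_prim divA zn1.
apply: (@symbol_x_not_scalar _ _ _ (a ^+ n) beta zeta_prim (a * c)) => //.
  exact: expf_neq0.
by rewrite -/x -scalerA -zc scalerA mulfV // scale1r.
Qed.

Theorem proposition2p3 (K : fieldExtType rat) (eps : K)
    (eps_prim : 3.-primitive_root eps)
    (K_eq_Q_eps : <<1; eps>>%VS = fullv)
    (alpha beta : K)
    (alpha_pm1 : alpha \in [:: -1; 1]) (beta_pm1 : beta \in [:: -1; 1]) :
  ~ is_division_algebra (symbol_algebra alpha beta eps_prim).
Proof.
have pm1_neq0 (c : K) : c \in [:: -1; 1] -> c != 0.
  by rewrite !inE => /orP[] /eqP->; rewrite ?oppr_eq0 oner_eq0.
have -> : alpha = alpha ^+ 3.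
  move: alpha_pm1; rewrite !inE => /orP[] /eqP->; last by rewrite expr1n.
  by rewrite -signr_odd expr1.
by apply: symbol_algebra_not_division; rewrite ?pm1_neq0.
Qed.
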